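(* Let $F=g+h\circ c$ be the composite function described in the context, with $\mu=L\beta$, and assume $M:=\sup_{x,y\in\operatorname{dom} g}\|x-y\|<\infty$. Let $\rho\ge0$ be a weak convexity constant of $h\circ c$ on $\operatorname{dom} g$ and let $r\ge0$ be a convexity constant of the pair $(h,c)$ on $\operatorname{dom} g$. Fix a real $\tilde\mu>\mu$, points $x_0,v_0\in\operatorname{dom} g$, and sequences $\varepsilon_k,\delta_k\ge0$ ($k\ge1$). For $k\ge1$ set $a_k=\frac{2}{k+1}$, $y_k=a_kv_{k-1}+(1-a_k)x_{k-1}$, and let $(x_k,\zeta_k)$ and $(v_k,\xi_k)$ be any pairs such that $\|\zeta_k\|\le\varepsilon_k$, $x_k$ is the minimizer of $$z\mapsto g(z)+h\big(\zeta_k+c(y_k)+\nabla c(y_k)(z-y_k)\big)+\frac{\tilde\mu}{2}\|z-y_k\|^2,$$ $\|\xi_k\|\le\delta_k$, and $v_k$ is the minimizer of $$v\mapsto g(v)+\frac1{a_k}h\big(\xi_k+c(y_k)+a_k\nabla c(y_k)(v-v_{k-1})\big)+\frac{\tilde\mu a_k}{2}\|v-v_{k-1}\|^2.$$ Let $x^*$ be any point satisfying $F(x^* )\le F(x_k)$ for all iterates $x_k$. Then for every $N\ge1$, $$\min_{j=1,\ldots,N}\|\mathcal{G}_{1/\tilde\mu}(y_j)\|^2\le\frac{48\tilde\mu^2}{\tilde\mu-\mu}\left(\frac{\tilde\mu\|x^*-v_0\|^2}{N(N+1)(2N+1)}+\frac{M^2\big(r+\frac\rho2(N+3)\big)}{(N+1)(2N+1)}+\frac{4L\sum_{j=1}^N\frac{2\varepsilon_j+\delta_j}{a_j^2}}{N(N+1)(2N+1)}\right).$$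 Moreover, in the case $r=0$, the inequality above holds with the second summand in the parentheses on the right-hand side replaced by zero (even if $M=\infty$), and $$F(x_N)-F(x^* )\le\frac{2\tilde\mu\|v_0-x^*\|^2+8L\sum_{j=1}^N\frac{\varepsilon_j+\delta_j}{a_j^2}}{(N+1)^2}.$$
   Context: Setting: $g\colon\mathbf{R}^d\to\mathbf{R}\cup\{+\infty\}$ is proper, closed and convex; $h\colon\mathbf{R}^m\to\mathbf{R}$ is convex and $L$-Lipschitz continuous; $c\colon\mathbf{R}^d\to\mathbf{R}^m$ is $C^1$-smooth with $\|\nabla c(x)-\nabla c(y)\|_{\rm op}\le\beta\|x-y\|$ for all $x,y$. Set $\mu:=L\beta$ and $F(x):=g(x)+h(c(x))$. For $t>0$: $F_t(z;y):=g(z)+h\big(c(y)+\nabla c(y)(z-y)\big)+\frac{1}{2t}\|z-y\|^2$, $S_t(y):=\operatorname{argmin}_zF_t(z;y)$, $\mathcal{G}_t(x):=t^{-1}(x-S_t(x))$. Weak convexity: $\Phi$ is $\rho$-weakly convex on a set $U$ ($\rho$ is a weak convexity constant of $\Phi$ on $U$) if $\Phi(ax+(1-a)y)\le a\Phi(x)+(1-a)\Phi(y)+\rho a(1-a)\|x-y\|^2$ for all $x,y\in U$, $a\in[0,1]$. Convexity of the pair: $r\ge0$ is a convexity constant of $(h,c)$ on $U$ if $h\big(c(y)+\nabla c(y)(z-y)\big)\le h(c(z))+\frac r2\|z-y\|^2$ for all $z,y\in U$. Such constants exist with $0\le\rho\le r\le\mu$, and without loss of generality the paper takes $0\le\rho\le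 r\le\mu$. *)

(* Defs.v *)
From HB Require Import structures.
From mathcomp Require Import all_boot all_order all_algebra.
From mathcomp Require Import all_classical all_reals all_analysis.
Set Implicit Arguments.
Unset Strict Implicit.
Unset Printing Implicit Defensive.
Import Order.TTheory GRing.Theory Num.Theory.
Import numFieldNormedType.Exports.
Local Open Scope classical_set_scope.
Local Open Scope ring_scope.

(* Vectors are row vectors.  The library norm on matrices is the sup norm, so
   the Euclidean norm has to be defined; both induce the same topology, hence
   the same notions of lower semicontinuity, differentiability and
   continuity. *)
Definition enorm (R : realType) (n : nat) (x : 'rV[R]_n) : R :=
  Num.sqrt (\sum_(i < n) x 0 i ^+ 2).

(* Operator norm, for the Euclidean norms, of v |-> v *m A. *)
Definition opnorm (R : realType) (n m : nat) (A : 'M[R]_(n, m)) : R :=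
  sup [set enorm (v *m A) | v in [set v : 'rV[R]_n | enorm v <= 1]].

Definition edom (R : realType) (n : nat) (g : 'rV[R]_n -> \bar R) :
    set 'rV[R]_n :=
  [set x | (g x < +oo)%E].

Definition eproper (R : realType) (n : nat) (g : 'rV[R]_n -> \bar R) : Prop :=
  (forall x, g x != -oo%E) /\ edom g !=set0.

(* The library's convex_function is only for real-valued functions.  The
   convention 0 * +oo = 0 makes the cases t = 0 and t = 1 trivial. *)
Definition econvex (R : realType) (n : nat) (g : 'rV[R]_n -> \bar R) : Prop :=
  forall (x y : 'rV[R]_n) (t : R), 0 <= t <= 1 ->
    (g (t *: x + (1 - t) *: y)%R <= t%:E * g x + (1 - t)%:E * g y)%E.

Definition elipschitz (R : realType) (m : nat) (L : R)
    (h : 'rV[R]_m -> R) : Prop :=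
  forall u w, `|h u - h w| <= L * enorm (u - w).

Definition C1 (R : realType) (d m : nat) (c : 'rV[R]_d -> 'rV[R]_m) : Prop :=
  (forall x, differentiable c x) /\ continuous (fun x => 'J c x).

(* c(y) + \nabla c(y) w; the library's Jacobian 'J acts on row vectors from the
   right, i.e. it is the transpose of the usual one. *)
Definition linearization (R : realType) (d m : nat)
    (c : 'rV[R]_d -> 'rV[R]_m) (y w : 'rV[R]_d) : 'rV[R]_m :=
  c y + w *m 'J c y.

Definition weak_convexity_constant (R : realType) (d : nat)
    (U : set 'rV[R]_d) (Phi : 'rV[R]_d -> R) (rho : R) : Prop :=
  forall x y (a : R), U x -> U y -> 0 <= a <= 1 ->
    Phi (a *: x + (1 - a) *: y) <=
    a * Phi x + (1 - a) * Phi y + rho * a * (1 - a) * enorm (x - y) ^+ 2.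

Definition pair_convexity_constant (R : realType) (d m : nat)
    (U : set 'rV[R]_d) (h : 'rV[R]_m -> R) (c : 'rV[R]_d -> 'rV[R]_m)
    (r : R) : Prop :=
  forall z y, U z -> U y ->
    h (linearization c y (z - y)) <= h (c z) + r / 2 * enorm (z - y) ^+ 2.

Definition argmin (R : realType) (n : nat) (phi : 'rV[R]_n -> \bar R) :
    set 'rV[R]_n :=
  [set x | forall z, (phi x <= phi z)%E].

Definition ediam (R : realType) (n : nat) (D : set 'rV[R]_n) : \bar R :=
  ereal_sup [set (enorm (p.1 - p.2))%:E | p in D `*` D].

Section composite.
Variables (R : realType) (d m : nat).
Variables (g : 'rV[R]_d -> \bar R) (h : 'rV[R]_m -> R).
Variable c : 'rV[R]_d -> 'rV[R]_m.

Definition objective (x : 'rV[R]_d) : \bar R := (g x + (h (c x))%:E)%E.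

Definition prox_model (t : R) (y z : 'rV[R]_d) : \bar R :=
  (g z + (h (linearization c y (z - y)) +
          1 / (2 * t) * enorm (z - y) ^+ 2)%:E)%E.

(* The minimizer of prox_model t y, which exists and is unique for t > 0, g
   proper closed convex and h convex. *)
Definition prox_step (t : R) (y : 'rV[R]_d) : 'rV[R]_d :=
  get (argmin (prox_model t y)).

Definition prox_gradient (t : R) (x : 'rV[R]_d) : 'rV[R]_d :=
  t^-1 *: (x - prox_step t x).

Definition x_subproblem (mut : R) (zeta : 'rV[R]_m) (y z : 'rV[R]_d) :
    \bar R :=
  (g z + (h (zeta + linearization c y (z - y)) +
          mut / 2 * enorm (z - y) ^+ 2)%:E)%E.

(* vp is the previous point v_{k-1}. *)
Definition v_subproblem (mut a : R) (xi : 'rV[R]_m) (y vp v : 'rV[R]_d) :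
    \bar R :=
  (g v + (1 / a * h (xi + linearization c y (a *: (v - vp))) +
          mut * a / 2 * enorm (v - vp) ^+ 2)%:E)%E.

End composite.

Definition accel_weight (R : realType) (k : nat) : R := 2 / k.+1%:R.

(* Only meaningful for k >= 1. *)
Definition accel_point (R : realType) (d : nat) (x v : nat -> 'rV[R]_d)
    (k : nat) : 'rV[R]_d :=
  accel_weight R k *: v k.-1 + (1 - accel_weight R k) *: x k.-1.

(* Main.v *)
Require Import Defs.
From HB Require Import structures.
From mathcomp Require Import all_boot all_order all_algebra.
From mathcomp Require Import all_classical all_reals all_analysis.
From mathcomp Require Import ring lra.
Import Order.TTheory GRing.Theory Num.Theory.
Import numFieldNormedType.Exports.
Local Open Scope classical_set_scope.
Local Open Scope ring_scope.

(** The two convergence rates come from one energy inequality for the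
    accelerated method.

    Each subproblem is g plus a convex function plus a quadratic, so a strongly
    convex problem: at a distance t from its minimizer its value exceeds the
    minimum by at least half its modulus times t^2 ([argmin_growth]).  The
    linearization of c errs by at most beta/2 times the squared distance
    ([linearization_error]), so the x-subproblem with modulus mut majorizes F
    up to L * eps, with (mut - L * beta)/2 * |x_k - y_k|^2 to spare
    ([model_upper]).  Comparing x_k with a_k v_k + (1 - a_k) x_{k-1}, then v_k
    with the comparison point xstar, and finally going back from the model to F
    by means of r and rho, gives [accel_step]: F(x_k) - F(xstar) contracts by the
    factor 1 - a_k up to a telescoping difference of squared distances of v_k
    to xstar and the error terms.  Dividing by a_k^2 and using
    (1 - a_k) / a_k^2 <= 1 / a_{k-1}^2, the inequalities add up
    ([accel_telescope], [accel_energy]); the result bounds at once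
    F(x_N) - F(xstar) and the weighted sum of the |x_j - y_j|^2.

    The exact prox step at y_j minimizes the x-subproblem without perturbation.
    It exists because that subproblem is bounded below, closed and strongly
    convex ([strongly_convex_argmin_exists]), and it lies within
    sqrt (2 L eps_j / mut) of x_j ([inexact_prox_dist]).  Hence the
    prox-gradient at y_j is controlled by |x_j - y_j| and eps_j.  Since the
    weights 1 / a_j^2 add up to at least N (N + 1) (2 N + 1) / 24, the weighted
    sum dominates the least prox-gradient ([accel_min_prox_gradient]).

    If r = 0 then h o c is convex on the domain of g, so that rho can be taken
    to be 0 as well ([pair_convexity0_convex]), and the diameter terms
    disappear. *)

(** * Euclidean geometry and operator norms *)

Lemma enorm_ge0 {R : realType} {n} (x : 'rV[R]_n) : 0 <= enorm x.
Proof. exact: sqrtr_ge0. Qed.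

Lemma sum_sqr_ge0 {R : realType} {I : finType} (f : I -> R) :
  0 <= \sum_i f i ^+ 2.
Proof. by apply: sumr_ge0 => i _; exact: sqr_ge0. Qed.

Lemma enorm_sqr {R : realType} {n} (x : 'rV[R]_n) :
  enorm x ^+ 2 = \sum_i x 0 i ^+ 2.
Proof. by rewrite sqr_sqrtr// sum_sqr_ge0. Qed.

Lemma enorm_distC {R : realType} {n} (x y : 'rV[R]_n) :
  enorm (x - y) = enorm (y - x).
Proof.
by congr Num.sqrt; apply: eq_bigr => i _; rewrite !mxE -sqrrN opprB.
Qed.

Lemma enormZ {R : realType} {n} (a : R) (x : 'rV[R]_n) :
  enorm (a *: x) = `|a| * enorm x.
Proof.
rewrite /enorm -sqrtr_sqr -sqrtrM ?sqr_ge0// mulr_sumr.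
by congr Num.sqrt; apply: eq_bigr => i _; rewrite mxE exprMn.
Qed.

Lemma enorm0 {R : realType} {n} : enorm (0 : 'rV[R]_n) = 0.
Proof. by rewrite -(scale0r 0) enormZ normr0 mul0r. Qed.

(** The exact convexity defect of the squared norm: it makes a subproblem
    strongly convex with modulus twice the coefficient of its quadratic. *)
Lemma enorm_sqr_conv {R : realType} {n} (t : R) (x y : 'rV[R]_n) :
  enorm (t *: x + (1 - t) *: y) ^+ 2 =
  t * enorm x ^+ 2 + (1 - t) * enorm y ^+ 2
  - t * (1 - t) * enorm (x - y) ^+ 2.
Proof.
rewrite !enorm_sqr !mulr_sumr -!big_split/= -sumrB.
by apply: eq_bigr => i _; rewrite !mxE; ring.
Qed.

Lemma enorm_sqrD_le {R : realType} {n} (x y z : 'rV[R]_n) :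
  enorm (x - z) ^+ 2 <= 2 * (enorm (x - y) ^+ 2 + enorm (y - z) ^+ 2).
Proof.
rewrite !enorm_sqr -big_split/= mulr_sumr; apply: ler_sum => i _.
rewrite !mxE -subr_ge0.
have -> : 2 * ((x 0 i - y 0 i) ^+ 2 + (y 0 i - z 0 i) ^+ 2)
  - (x 0 i - z 0 i) ^+ 2 = (x 0 i - 2 * y 0 i + z 0 i) ^+ 2 by ring.
exact: sqr_ge0.
Qed.

Lemma cauchy_schwarz_sum {R : realType} {I : finType} (a b : I -> R) :
  (\sum_i a i * b i) ^+ 2 <= (\sum_i a i ^+ 2) * (\sum_i b i ^+ 2).
Proof.
set A := \sum_i a i ^+ 2; set B := \sum_i b i ^+ 2.
set C := \sum_i a i * b i.
have [B0|B_neq0] := eqVneq B 0.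
  have b0 i : b i = 0.
    have /eqP := B0; rewrite psumr_eq0; last by move=> j _; exact: sqr_ge0.
    by move=> /allP/(_ i (mem_index_enum _)); rewrite sqrf_eq0 => /eqP.
  by rewrite /C big1 ?expr0n/= ?B0 ?mulr0// => i _; rewrite b0 mulr0.
have B_gt0 : 0 < B by rewrite lt_def B_neq0 sum_sqr_ge0.
(* The sum below equals B (A B - C ^ 2), so B can be cancelled. *)
have : 0 <= \sum_i (B * a i - C * b i) ^+ 2 by exact: sum_sqr_ge0.
have -> : \sum_i (B * a i - C * b i) ^+ 2 = B * (A * B - C ^+ 2).
  under eq_bigr => i _ do have -> : (B * a i - C * b i) ^+ 2 =
    B ^+ 2 * a i ^+ 2 - 2 * B * C * (a i * b i) + C ^+ 2 * b i ^+ 2 by ring.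
  by rewrite big_split sumrB/= -!mulr_sumr -/A -/B -/C; ring.
by rewrite pmulr_rge0// subr_ge0.
Qed.

Lemma enorm_dot {R : realType} {n} (x y : 'rV[R]_n) :
  \sum_i x 0 i * y 0 i <= enorm x * enorm y.
Proof.
apply: le_trans (ler_norm _) _.
rewrite -(ler_pXn2r (ltn0Sn 1)) ?nnegrE ?mulr_ge0 ?enorm_ge0//.
by rewrite real_normK ?num_real// exprMn !enorm_sqr cauchy_schwarz_sum.
Qed.

(** [opnorm] is a real supremum, which says something only about a bounded
    set; by Cauchy-Schwarz the Frobenius norm is a bound. *)
Lemma enorm_mulmx_bounded {R : realType} {n m} (A : 'M[R]_(n, m)) :
  exists K, forall v : 'rV[R]_n, enorm v <= 1 -> enorm (v *m A) <= K.
Proof.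
exists (Num.sqrt (\sum_j \sum_i A i j ^+ 2)) => v v1.
apply: ler_wsqrtr; apply: ler_sum => j _; rewrite mxE.
apply: le_trans (cauchy_schwarz_sum _ _) _.
rewrite -enorm_sqr ler_piMl ?sum_sqr_ge0// -(expr1n _ 2) ler_pXn2r ?nnegrE//.
exact: enorm_ge0.
Qed.

Lemma enorm_eq0 {R : realType} {n} (x : 'rV[R]_n) : enorm x = 0 -> x = 0.
Proof.
move=> x0; have /eqP : enorm x ^+ 2 = 0 by rewrite x0 expr0n.
rewrite enorm_sqr psumr_eq0; last by move=> j _; exact: sqr_ge0.
move=> /allP x0'; apply/rowP => i; rewrite mxE.
by have := x0' i (mem_index_enum _); rewrite sqrf_eq0 => /eqP.
Qed.

Lemma enorm_mulmx {R : realType} {n m} (A : 'M[R]_(n, m)) (v : 'rV[R]_n) :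
  enorm (v *m A) <= opnorm A * enorm v.
Proof.
have [v0|v_neq0] := eqVneq (enorm v) 0.
  by rewrite v0 mulr0 (enorm_eq0 _ v0) mul0mx enorm0.
have v_gt0 : 0 < enorm v by rewrite lt_def v_neq0 enorm_ge0.
rewrite -ler_pdivrMr//.
have [K AK] := enorm_mulmx_bounded A.
apply: ub_le_sup; first by exists K => _ [w w1 <-]; exact: AK.
exists ((enorm v)^-1 *: v).
  by rewrite /= enormZ ger0_norm ?invr_ge0 ?enorm_ge0// mulVf.
by rewrite -scalemxAl enormZ ger0_norm ?invr_ge0 ?enorm_ge0// mulrC.
Qed.

(** * Second-order error of the linearization *)

(** The difference quotient of c along a line is the one that defines the
    directional derivative of c, so no chain rule is involved. *)
Lemma is_derive_line {R : realType} {d m} (c : 'rV[R]_d -> 'rV[R]_m)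
    (y p : 'rV[R]_d) (t : R) (j : 'I_m) :
  differentiable c (y + t *: p) ->
  is_derive t (1 : R) (fun s : R => c (y + s *: p) 0 j)
    ((p *m 'J c (y + t *: p)) 0 j).
Proof.
move=> dc; have cD := @diff_derivable _ _ _ _ _ p dc.
have cDj := (derivable_mxP c (y + t *: p) p).1 cD 0 j.
have quotE : (fun h : R => h^-1 *: (c (y + (h *: (1 : R) + t) *: p) 0 j
    - c (y + t *: p) 0 j)) =
  (fun h : R => h^-1 *: (c (h *: p + (y + t *: p)) 0 j - c (y + t *: p) 0 j)).
  apply/funext => h; congr (_ *: (c _ 0 j - _)).
  by rewrite scalerDl scaler1 addrCA.
apply: DeriveDef; first by rewrite /derivable /= quotE.
rewrite /derive /= quotE -deriveEjacobian// derive_mx// mxE.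
by rewrite /derive.
Qed.

Lemma is_derive_subM {R : realType} (f : R -> R) (df t a b : R) :
  is_derive t (1 : R) f df ->
  is_derive t (1 : R) (fun s => f s - s * a - b * s ^+ 2)
    (df - a - 2 * b * t).
Proof.
move=> fD; apply: is_derive_eq; rewrite /GRing.scale/=; ring.
Qed.

(** Pair the error e with c along the segment from y to z, and subtract the
    linear part and the quadratic beta |z - y|^2 |e| t^2 / 2.  The derivative in
    t is at most 0, because the Jacobian moves by at most beta t |z - y| up to
    time t.  Comparing t = 1 with t = 0 bounds |e|^2 by a multiple of |e|, with
    the constant 1/2 that an estimate by the supremum of the derivative of c
    would lose. *)
Lemma linearization_error {R : realType} {d m} (c : 'rV[R]_d -> 'rV[R]_m)
    (beta : R) (y z : 'rV[R]_d) :
  0 <= beta -> (forall w, differentiable c w) ->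
  (forall u w, opnorm ('J c u - 'J c w) <= beta * enorm (u - w)) ->
  enorm (c z - linearization c y (z - y)) <= beta / 2 * enorm (z - y) ^+ 2.
Proof.
move=> beta0 c_diff c_smooth; set p := z - y; set e := c z - _.
pose q := p *m 'J c y; pose q_e := \sum_j q 0 j * e 0 j.
pose K := beta * enorm p ^+ 2 * enorm e / 2.
pose psi := fun t : R => \sum_j c (y + t *: p) 0 j * e 0 j
  - t * q_e - K * t ^+ 2.
pose dpsi := fun t : R => \sum_j (p *m 'J c (y + t *: p)) 0 j * e 0 j
  - q_e - 2 * K * t.
have psiD t : is_derive t (1 : R) psi (dpsi t).
  have D1 : is_derive t (1 : R) (fun s : R => \sum_j c (y + s *: p) 0 j * e 0 j)
      (\sum_j (p *m 'J c (y + t *: p)) 0 j * e 0 j).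
    have -> : (fun s : R => \sum_j c (y + s *: p) 0 j * e 0 j) =
      \sum_j (fun s : R => c (y + s *: p) 0 j * e 0 j).
      by apply/funext => s; rewrite fct_sumE.
    apply: is_derive_sum => j; have Dj := is_derive_line c y p t j (c_diff _).
    by apply: is_derive_eq; rewrite scaler0 add0r mulrC.
  have := is_derive_subM _ _ _ q_e K D1; rewrite -/(dpsi t).
  exact.
have dpsi_le0 t : 0 <= t -> dpsi t <= 0.
  move=> t0.
  have -> : dpsi t = \sum_j (p *m ('J c (y + t *: p) - 'J c y)) 0 j * e 0 j
      - beta * enorm p ^+ 2 * enorm e * t.
    have -> : beta * enorm p ^+ 2 * enorm e = 2 * K by rewrite /K; field.
    rewrite /dpsi -sumrB; congr (_ - _); apply: eq_bigr => j _.
    by rewrite mulmxBr [in RHS]mxE [X in (_ + X) * _]mxE mulrBl.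
  rewrite subr_le0; apply: le_trans (enorm_dot _ _) _.
  rewrite mulrAC ler_wpM2r ?enorm_ge0//.
  apply: le_trans (enorm_mulmx _ _) _.
  have := c_smooth (y + t *: p) y.
  rewrite [y + _ - y]addrC addKr enormZ ger0_norm// => le_op.
  apply: le_trans (ler_wpM2r (enorm_ge0 _) le_op) _.
  by rewrite le_eqVlt; apply/orP; left; apply/eqP; ring.
have psi10 : psi 1 <= psi 0.
  apply: (@ler0_derive1_le_cc _ psi 0 1).
  - by move=> t _; exact: ex_derive.
  - move=> t; rewrite in_itv/= => /andP[/ltW t0 _].
    by rewrite derive1E (@derive_val _ _ _ _ _ _ _ (psiD t)) dpsi_le0.
  - apply: derivable_within_continuous => t _; exact: ex_derive.
  - by rewrite in_itv/= lexx ler01.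
  - by rewrite in_itv/= lexx ler01.
  - exact: ler01.
have e_sqr : enorm e ^+ 2 <= beta / 2 * enorm p ^+ 2 * enorm e.
  rewrite enorm_sqr.
  have -> : \sum_i e 0 i ^+ 2 =
      psi 1 - psi 0 + beta / 2 * enorm p ^+ 2 * enorm e.
    rewrite /psi scale1r scale0r addr0 [y + p]addrC subrK.
    transitivity (\sum_j c z 0 j * e 0 j - \sum_j q 0 j * e 0 j
        - \sum_j c y 0 j * e 0 j); last by rewrite /q_e /K; field.
    rewrite -!sumrB; apply: eq_bigr => j _.
    have -> : q 0 j = c z 0 j - c y 0 j - e 0 j.
    by rewrite /e /linearization -/p -/q !mxE; ring.
  by ring.
  by rewrite gerDr subr_le0.
have [->|e_neq0] := eqVneq (enorm e) 0.
  by rewrite mulr_ge0 ?sqr_ge0// divr_ge0.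
have e_gt0 : 0 < enorm e by rewrite lt_def e_neq0 enorm_ge0.
by rewrite -(ler_pM2r e_gt0) -expr2.
Qed.

(** * Minimizing strongly convex functions *)

Section strongly_convex_minimization.
Context {R : realType} {n : nat}.
Variable g : 'rV[R]_n -> \bar R.
Hypotheses (g_proper : eproper g) (g_convex : econvex g).

Lemma edom_fineK z : edom g z -> g z = (fine (g z))%:E.
Proof.
move=> gz; rewrite fineK// fin_numElt gz andbT ltNye.
by have [/(_ z)] := g_proper.
Qed.

Lemma edom_convex_fine x y t : edom g x -> edom g y -> 0 <= t <= 1 ->
  edom g (t *: x + (1 - t) *: y) /\
  fine (g (t *: x + (1 - t) *: y)) <=
    t * fine (g x) + (1 - t) * fine (g y).
Proof.
move=> gx gy t01; have := g_convex x y t t01.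
rewrite (edom_fineK x gx) (edom_fineK y gy) -!EFinM -EFinD => le_g.
have dom_z : edom g (t *: x + (1 - t) *: y).
  by rewrite /edom /=; apply: le_lt_trans le_g _; exact: ltry.
by split=> //; move: le_g; rewrite (edom_fineK _ dom_z) lee_fin.
Qed.

Lemma edom_convex x y t : edom g x -> edom g y -> 0 <= t <= 1 ->
  edom g (t *: x + (1 - t) *: y).
Proof. by move=> gx gy t01; have [] := edom_convex_fine x y t gx gy t01. Qed.

Lemma fine_convex x y t : edom g x -> edom g y -> 0 <= t <= 1 ->
  fine (g (t *: x + (1 - t) *: y)) <= t * fine (g x) + (1 - t) * fine (g y).
Proof. by move=> gx gy t01; have [] := edom_convex_fine x y t gx gy t01. Qed.

Definition strongly_convex (s : R) (k : 'rV[R]_n -> R) : Prop :=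
  forall x y t, 0 <= t <= 1 ->
    k (t *: x + (1 - t) *: y) <=
    t * k x + (1 - t) * k y - s / 2 * (t * (1 - t)) * enorm (x - y) ^+ 2.

Lemma argmin_edom (k : 'rV[R]_n -> R) x :
  argmin (fun z => g z + (k z)%:E)%E x -> edom g x.
Proof.
move=> xmin; have [w gw] := g_proper.2; move: (xmin w).
rewrite (edom_fineK w gw) -EFinD /edom /= => le_x.
rewrite ltNge leye_eq; apply/negP => /eqP gx.
by move: le_x; rewrite gx addye// leye_eq.
Qed.

(** Compare x with the point at fraction t of the way to w: convexity of g and
    strong convexity of k bound its value, and after division by t the limit
    t -> 0 leaves the full quadratic term. *)
Lemma argmin_growth (s : R) (k : 'rV[R]_n -> R) x w :
  strongly_convex s k -> argmin (fun z => g z + (k z)%:E)%E x -> edom g w ->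
  fine (g x) + k x + s / 2 * enorm (w - x) ^+ 2 <= fine (g w) + k w.
Proof.
move=> k_sc xmin gw; have gx := argmin_edom k x xmin.
set C := s / 2 * _.
have le_t t : 0 < t <= 1 ->
    fine (g x) + k x + C <= fine (g w) + k w + t * C.
  move=> /andP[t0 t1]; have t01 : 0 <= t <= 1 by rewrite (ltW t0) t1.
  have := xmin (t *: w + (1 - t) *: x).
  rewrite (edom_fineK x gx) (edom_fineK _ (edom_convex w x t gw gx t01)).
  rewrite -!EFinD lee_fin => le_x.
  have le_g := fine_convex w x t gw gx t01.
  have le_k := k_sc w x t t01.
  have kE : s / 2 * (t * (1 - t)) * enorm (w - x) ^+ 2 = t * (1 - t) * C.
    by rewrite /C; ring.
  by rewrite -(ler_pM2l t0); rewrite kE in le_k; nra.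
have [C0|C0] := leP C 0.
  by have := le_t 1; rewrite ltr01 lexx mul1r => /(_ isT); lra.
apply/ler_addgt0Pr => e e0.
(* This t makes t * C at most e while staying in ]0, 1]. *)
pose t := Num.min 1 (e / C).
apply: le_trans (le_t t _) _.
  by rewrite lt_min ltr01 divr_gt0//= ge_min lexx.
by rewrite lerD2l -ler_pdivlMr// ge_min lexx orbT.
Qed.

(** The midpoint of two near-minimizers has value at least I, while strong
    convexity puts it below their average by s/8 times their squared
    distance. *)
Lemma strongly_convex_cauchy (s : R) (k : 'rV[R]_n -> R) (I e : R) x y :
  strongly_convex s k ->
  (forall z, edom g z -> I <= fine (g z) + k z) ->
  edom g x -> edom g y ->
  fine (g x) + k x <= I + e -> fine (g y) + k y <= I + e ->
  s / 8 * enorm (x - y) ^+ 2 <= e.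
Proof.
move=> k_sc I_le gx gy xe ye.
have t01 : 0 <= (1 / 2 : R) <= 1 by apply/andP; split; lra.
have := I_le _ (edom_convex x y _ gx gy t01).
have := fine_convex x y _ gx gy t01; have := k_sc x y _ t01.
set E := enorm _ ^+ 2.
have -> : s / 2 * (1 / 2 * (1 - 1 / 2)) * E = s / 8 * E by field.
by lra.
Qed.

(** A minimizing sequence is Cauchy by [strongly_convex_cauchy], and lower
    semicontinuity of g passes to its limit.  A lower bound b is a hypothesis
    instead of a consequence of coercivity: here it comes from a perturbed
    problem whose minimizer is given. *)
Lemma strongly_convex_argmin_exists (s b : R) (k : 'rV[R]_n -> R) :
  0 < s -> lower_semicontinuous g -> strongly_convex s k -> continuous k ->
  (forall z, edom g z -> b <= fine (g z) + k z) ->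
  exists z, argmin (fun z => g z + (k z)%:E)%E z.
Proof.
move=> s0 g_lsc k_sc k_cont b_le.
pose V := [set fine (g z) + k z | z in edom g]; pose I := inf V.
have V_lb : has_lbound V by exists b => _ [z gz <-]; exact: b_le.
have V0 : V !=set0 by have [w gw] := g_proper.2; exists (fine (g w) + k w), w.
have I_le z : edom g z -> I <= fine (g z) + k z.
  by move=> gz; apply: ge_inf => //; exists z.
have /boolp.choice[u uP] : forall i : nat, exists z, edom g z /\
    fine (g z) + k z < I + i.+1%:R^-1.
  move=> i; have i0 : 0 < i.+1%:R^-1 :> R by rewrite invr_gt0.
  by have [_ [z gz <-] lt_z] := inf_adherent i0 (conj V0 V_lb); exists z.
have u_le i j : (i <= j)%N -> fine (g (u j)) + k (u j) <= I + i.+1%:R^-1.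
  move=> ij; apply: le_trans (ltW (uP j).2) _.
  by rewrite lerD2l lef_pV2 ?posrE// ler_nat.
have u_cauchy : cauchy (u @ \oo).
  apply: cauchy_exP => e e0.
  have se0 : 0 < s / 8 * e ^+ 2 by rewrite mulr_gt0 ?divr_gt0 ?exprn_gt0.
  have [i _ iP] := near_infty_natSinv_lt (PosNum se0).
  exists (u i); exists i => // j /= ij; split=> // r l.
  rewrite /ball /= ord1 -(ltr_pXn2r (ltn0Sn 1)) ?nnegrE ?(ltW e0)//.
  have := strongly_convex_cauchy s k I i.+1%:R^-1 (u i) (u j) k_sc I_le
    (uP i).1 (uP j).1 (u_le i i (leqnn i)) (u_le i j ij).
  move=> /le_lt_trans/(_ (iP i (leqnn i))) /=.
  rewrite ltr_pM2l ?divr_gt0//; apply: le_lt_trans.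
  rewrite enorm_sqr (bigD1 l)//= real_normK ?num_real// !mxE lerDl.
  by apply: sumr_ge0 => ? _; exact: sqr_ge0.
have u_cvg : cvg (u @ \oo) by exact: cauchy_cvg.
pose l := lim (u @ \oo); have u_l : u @ \oo --> l by exact: u_cvg.
clearbody l.
(* The limit value is approached through reals a below g l, since g l
   might a priori be infinite. *)
have l_le a : (a%:E < g l)%E -> a + k l <= I.
  move=> /g_lsc[W Wl Wa]; apply/ler_addgt0Pr => e e0.
  have e20 : 0 < e / 2 by rewrite divr_gt0.
  have k_near : \forall i \near \oo, `|k l - k (u i)| < e / 2.
    have /cvgrPdist_lt/(_ _ e20) := cvg_comp _ _ u_l (k_cont l).
    exact.
  near \oo => i.
  have Wu : W (u i) by near: i; exact: u_l.
  have := Wa _ Wu; rewrite (edom_fineK _ (uP i).1) lte_fin => a_lt.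
  have k_lt : `|k l - k (u i)| < e / 2 by near: i.
  have i_lt : i.+1%:R^-1 < e / 2.
    by near: i; exact: (near_infty_natSinv_lt (PosNum e20)).
  have := (uP i).2; have := ler_norm (k l - k (u i)); move: a_lt k_lt i_lt.
  move: (fine _) (i.+1%:R^-1 : R) => G E; lra.
have gl : edom g l.
  rewrite /edom /= ltNge leye_eq; apply/negP => /eqP gl.
  have := l_le (I - k l + 1); rewrite gl ltry => /(_ isT). lra.
exists l => z; have [gz|] := boolP (g z < +oo)%E; last first.
  rewrite -leNgt leye_eq => /eqP ->; rewrite addye//; exact: leey.
rewrite (edom_fineK l gl) (edom_fineK z gz) -!EFinD lee_fin.
apply: le_trans (I_le z gz); rewrite leNgt; apply/negP => I_lt.
have := l_le ((fine (g l) + (I - k l)) / 2).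
by rewrite [X in (_ < X)%E](edom_fineK l gl) lte_fin; lra.
Unshelve. all: by end_near. Qed.

End strongly_convex_minimization.

(** * Convexity and continuity of the model functions *)

Lemma convex_function_real {R : realType} {m} (h : 'rV[R]_m -> R) u w t :
  convex_function setT h -> 0 <= t <= 1 ->
  h (t *: u + (1 - t) *: w) <= t * h u + (1 - t) * h w.
Proof.
move=> h_convex /andP[t0 t1].
by have := h_convex (Itv01 t0 t1) u w (mem_setT u) (mem_setT w).
Qed.

Definition affine_map {R : realType} {d m} (q : 'rV[R]_d -> 'rV[R]_m) :=
  forall x y t, q (t *: x + (1 - t) *: y) = t *: q x + (1 - t) *: q y.

(** Covers both subproblems: a = 1 and p = y for the x-step, a = a_k and
    p = v_{k-1} for the v-step. *)
Lemma affine_model {R : realType} {d m} (c : 'rV[R]_d -> 'rV[R]_m)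
    (zeta : 'rV[R]_m) (y p : 'rV[R]_d) (a : R) :
  affine_map (fun z => zeta + linearization c y (a *: (z - p))).
Proof.
move=> u w t; rewrite /linearization.
have -> : a *: (t *: u + (1 - t) *: w - p) =
    t *: (a *: (u - p)) + (1 - t) *: (a *: (w - p)).
  by apply/rowP => i; rewrite !mxE; ring.
rewrite mulmxDl -!scalemxAl; move: (_ *m _) (_ *m _) => P Q.
by apply/rowP => i; rewrite !mxE; ring.
Qed.

Lemma strongly_convex_model {R : realType} {d m} (h : 'rV[R]_m -> R)
    (q : 'rV[R]_d -> 'rV[R]_m) (w s : R) (p : 'rV[R]_d) :
  convex_function setT h -> affine_map q -> 0 <= w ->
  strongly_convex s (fun z => w * h (q z) + s / 2 * enorm (z - p) ^+ 2).
Proof.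
move=> h_convex q_affine w0 x y t t01.
have -> : t *: x + (1 - t) *: y - p = t *: (x - p) + (1 - t) *: (y - p).
  by apply/rowP => i; rewrite !mxE; ring.
rewrite enorm_sqr_conv q_affine.
have -> : x - p - (y - p) = x - y by apply/rowP => i; rewrite !mxE; ring.
have := ler_wpM2l w0 (convex_function_real h (q x) (q y) t h_convex t01).
by move: (enorm _ ^+ 2) (enorm _ ^+ 2) (enorm _ ^+ 2) => X Y Z; lra.
Qed.

Lemma enorm_continuous {R : realType} {n} : continuous (@enorm R n).
Proof.
move=> x; apply: continuous_comp; last exact: sqrt_continuous.
apply: continuous_big => [|i _]; first exact: add_continuous.
move=> y; apply: (@continuous_comp _ _ _ (fun v : 'rV[R]_n => v 0 i)
  (fun r => r ^+ 2)); [exact: coord_continuous|exact: exprn_continuous].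
Qed.

Lemma elipschitz_continuous {R : realType} {n} (K : R) (f : 'rV[R]_n -> R) :
  elipschitz K f -> continuous f.
Proof.
move=> f_lip x; apply/(@cvgrPdist_le _ _ _ _ (nbhs_filter x)) => e e0.
have cont : continuous (fun y : 'rV[R]_n => K * enorm (x - y)).
  move=> y; apply: (@continuous_comp _ _ _ (fun y : 'rV[R]_n => enorm (x - y))
    (fun r => K * r)); last exact: mulrl_continuous.
  apply: (@continuous_comp _ _ _ (fun y : 'rV[R]_n => x - y) (@enorm R n)).
    by apply: continuousB; [exact: cst_continuous|].
  exact: enorm_continuous.
have := cont x; rewrite /continuous_at subrr enorm0 mulr0 => cvg0.
move/(@cvgrPdist_le _ _ _ _ (nbhs_filter x)) : cvg0 => /(_ e e0).
apply: filterS => y.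
rewrite sub0r normrN => le_e; apply: le_trans (f_lip x y) _.
exact: le_trans (ler_norm _) le_e.
Qed.

Lemma elipschitz_linearization {R : realType} {d m} (h : 'rV[R]_m -> R)
    (c : 'rV[R]_d -> 'rV[R]_m) (L : R) (y : 'rV[R]_d) :
  0 <= L -> elipschitz L h ->
  elipschitz (L * opnorm ('J c y)) (fun z => h (linearization c y (z - y))).
Proof.
move=> L0 h_lip u w; apply: le_trans (h_lip _ _) _; rewrite -mulrA ler_wpM2l//.
have -> : linearization c y (u - y) - linearization c y (w - y) =
    (u - w) *m 'J c y.
  by rewrite /linearization !mulmxBl; apply/rowP => i; rewrite !mxE; ring.
exact: enorm_mulmx.
Qed.

Lemma enorm_sqr_continuous {R : realType} {n} (s : R) (y : 'rV[R]_n) :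
  continuous (fun z : 'rV[R]_n => s * enorm (z - y) ^+ 2).
Proof.
move=> z; apply: (@continuous_comp _ _ _ (fun z : 'rV[R]_n => enorm (z - y))
  (fun r => s * r ^+ 2)).
  apply: (@continuous_comp _ _ _ (fun z : 'rV[R]_n => z - y) (@enorm R n)).
    by apply: continuousB; [|exact: cst_continuous].
  exact: enorm_continuous.
apply: (@continuous_comp _ _ _ (fun r : R => r ^+ 2) (fun r => s * r)).
  exact: exprn_continuous.
exact: mulrl_continuous.
Qed.

(** * Consequences of a bounded domain and of a convex pair *)

Lemma ediam_enorm_sqr_le {R : realType} {n} (U : set 'rV[R]_n) p q :
  (ediam U < +oo)%E -> U p -> U q ->
  enorm (p - q) ^+ 2 <= fine (ediam U) ^+ 2.
Proof.
move=> M_fin Up Uq.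
have M_ge : ((enorm (p - q))%:E <= ediam U)%E.
  by apply: ereal_sup_ubound; exists (p, q).
have M_num : ediam U \is a fin_num.
  by rewrite fin_numElt M_fin andbT; apply: lt_le_trans M_ge; exact: ltNyr.
rewrite ler_sqr ?nnegrE ?enorm_ge0//.
  by rewrite -lee_fin fineK.
apply: fine_ge0; apply: le_trans M_ge; rewrite lee_fin; exact: enorm_ge0.
Qed.

(** Linearize at the point w of the segment: the linearizations at the two
    endpoints, weighted by a and 1 - a, add up to c w.  Convexity of h and the
    pair inequality with constant 0 then bound h (c w) by the same combination
    of the endpoint values. *)
Lemma pair_convexity0_convex {R : realType} {d m} (U : set 'rV[R]_d)
    (h : 'rV[R]_m -> R) (c : 'rV[R]_d -> 'rV[R]_m) :
  (forall x y (a : R), U x -> U y -> 0 <= a <= 1 ->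
    U (a *: x + (1 - a) *: y)) ->
  convex_function setT h -> pair_convexity_constant U h c 0 ->
  weak_convexity_constant U (h \o c) 0.
Proof.
move=> U_conv h_convex pair0 x y a Ux Uy a01; rewrite !mul0r addr0 /=.
set w := a *: x + (1 - a) *: y; have Uw : U w := U_conv x y a Ux Uy a01.
have wE : c w = a *: linearization c w (x - w)
    + (1 - a) *: linearization c w (y - w).
  have <- : linearization c w (a *: (x - w) + (1 - a) *: (y - w)) = c w.
    have -> : a *: (x - w) + (1 - a) *: (y - w) = 0.
      by apply/rowP => i; rewrite /w !mxE; ring.
    by rewrite /linearization mul0mx addr0.
  rewrite /linearization mulmxDl -!scalemxAl.
  by move: (_ *m _) (_ *m _) => P Q; apply/rowP => i; rewrite !mxE; ring.
rewrite wE; apply: le_trans (convex_function_real h _ _ a h_convex a01) _.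
have /andP[a0 a1] := a01; apply: lerD.
  by rewrite ler_wpM2l//; have := pair0 x w Ux Uw; rewrite !mul0r addr0.
rewrite ler_wpM2l ?subr_ge0//.
by have := pair0 y w Uy Uw; rewrite !mul0r addr0.
Qed.

(** * Telescoping with the weights 2 / (k + 1) *)

Lemma accel_weight_gt0_le1 {R : realType} k :
  (1 <= k)%N -> 0 < accel_weight R k <= 1.
Proof.
move=> k1; rewrite /accel_weight divr_gt0//= ler_pdivrMr// mul1r.
by rewrite ler_nat.
Qed.

Lemma accel_weight_sqr_inv {R : realType} k (u : R) :
  u / accel_weight R k ^+ 2 = u * (k%:R + 1) ^+ 2 / 4.
Proof.
have k1 : k%:R + 1 != 0 :> R by rewrite natr1 pnatr_eq0.
by rewrite /accel_weight -natr1; field.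
Qed.

(** Division by a ^ 2, where a = 2 / (k + 2) is the weight of step k + 1; it
    gives the squared distances the same coefficient in every step. *)
Lemma accel_scaled_step {R : realType} (s x0 x1 v0 v1 w b C C' E k : R) :
  0 <= k ->
  let a := 2 / (k + 2) in
  x1 + s * a ^+ 2 / 2 * v1 + b / 2 * w <=
    (1 - a) * x0 + s * a ^+ 2 / 2 * v0
    + (C * a ^+ 2 / 2 + C' * a * (1 - a)) + E ->
  x1 * (k + 2) ^+ 2 / 4 + s / 2 * v1 + b / 2 * (w * (k + 2) ^+ 2 / 4) <=
    k * (k + 2) / 4 * x0 + s / 2 * v0 + C / 2 + C' * k / 2
    + E * (k + 2) ^+ 2 / 4.
Proof.
move=> k0 a step; have k2 : k + 2 != 0 by rewrite gt_eqF// ltr_wpDl.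
have scale0 : 0 <= (k + 2) ^+ 2 / 4 by rewrite divr_ge0// sqr_ge0.
have := ler_wpM2l scale0 step.
have -> : (k + 2) ^+ 2 / 4 * (x1 + s * a ^+ 2 / 2 * v1 + b / 2 * w) =
  x1 * (k + 2) ^+ 2 / 4 + s / 2 * v1 + b / 2 * (w * (k + 2) ^+ 2 / 4).
  by rewrite /a; field.
have -> // : (k + 2) ^+ 2 / 4 * ((1 - a) * x0 + s * a ^+ 2 / 2 * v0
    + (C * a ^+ 2 / 2 + C' * a * (1 - a)) + E) =
  k * (k + 2) / 4 * x0 + s / 2 * v0 + C / 2 + C' * k / 2
    + E * (k + 2) ^+ 2 / 4.
by rewrite /a; field.
Qed.

(** After the scaling, the coefficient k (k + 2) / 4 of the old gap is at most
    the coefficient (k + 1)^2 / 4 that the previous step has left on it, so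
    nonnegative gaps telescope.  In the first step the weight is 1, which
    removes gap 0, whose sign is unknown. *)
Lemma accel_telescope {R : realType} (gap V W E : nat -> R)
    (s b C C' : R) N :
  let a := accel_weight R in
  (forall k, (1 <= k)%N -> 0 <= gap k) ->
  (forall k, (1 <= k)%N ->
    gap k + s * a k ^+ 2 / 2 * V k + b / 2 * W k <=
    (1 - a k) * gap k.-1 + s * a k ^+ 2 / 2 * V k.-1
    + (C * a k ^+ 2 / 2 + C' * a k * (1 - a k)) + E k) ->
  (1 <= N)%N ->
  gap N * (N%:R + 1) ^+ 2 / 4 + s / 2 * V N
    + b / 2 * (\sum_(1 <= j < N.+1) W j / a j ^+ 2) <=
  s / 2 * V 0%N + C * N%:R / 2 + C' * (N%:R * (N%:R - 1)) / 4
    + \sum_(1 <= j < N.+1) E j / a j ^+ 2.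
Proof.
move=> a gap_ge0 step.
have scaled k : gap k.+1 * (k%:R + 2) ^+ 2 / 4 + s / 2 * V k.+1
    + b / 2 * (W k.+1 / a k.+1 ^+ 2) <=
    k%:R * (k%:R + 2) / 4 * gap k + s / 2 * V k + C / 2 + C' * k%:R / 2
    + E k.+1 / a k.+1 ^+ 2.
  have kE : k.+2%:R = k%:R + 2 :> R by rewrite -addn2 natrD.
  have kE' : k.+1%:R + 1 = k%:R + 2 :> R by rewrite natr1.
  rewrite !accel_weight_sqr_inv !kE'.
  apply: (@accel_scaled_step _ s _ _ _ _ _ _ _ _ _ k%:R) => //.
  by have := step k.+1 (ltn0Sn k); rewrite /a /accel_weight kE.
elim: N => // -[_ _|N IH _].
  rewrite !big_nat1; have := scaled 0%N; rewrite !add0r.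
  by rewrite -[1 + 1]/(2 : R) subrr; lra.
rewrite !(big_nat_recr N.+2)//=.
have := IH isT; have := scaled N.+1; have := gap_ge0 N.+1 (ltn0Sn N).
rewrite -[N.+2%:R]natr1.
have : 0 <= N.+1%:R :> R by [].
move: (N.+1%:R : R) (\sum_(_ <= _ < _) _) (\sum_(_ <= _ < _) _) => n SW SE.
move: (W _ / _) (E _ / _) (gap _) (gap _) => w e x1 x0 n0 x0_ge0 sc IHn.
have : n * (n + 2) * x0 <= (n + 1) ^+ 2 * x0.
  by apply: ler_wpM2r => //; rewrite -subr_ge0;
    have -> : (n + 1) ^+ 2 - n * (n + 2) = 1 by ring.
lra.
Qed.

Lemma sum_accel_weight_inv_ge {R : realType} N :
  N%:R * (N%:R + 1) * (2 * N%:R + 1) / 24 <=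
  \sum_(1 <= j < N.+1) 1 / accel_weight R j ^+ 2.
Proof.
elim: N => [|N IH]; first by rewrite big_geq// !mul0r.
rewrite big_nat_recr//=; apply: le_trans (lerD IH (lexx _)).
rewrite accel_weight_sqr_inv -natr1.
have : 0 <= N%:R :> R by [].
by move: (N%:R : R) => n n0; nra.
Qed.

(** * The accelerated prox-linear method *)

Section composite_step.
Context {R : realType} {d m : nat}.
Variables (g : 'rV[R]_d -> \bar R) (h : 'rV[R]_m -> R).
Variable c : 'rV[R]_d -> 'rV[R]_m.
Variables (L beta mut : R).
Hypotheses (g_proper : eproper g) (g_convex : econvex g).
Hypotheses (h_convex : convex_function setT h).
Hypotheses (L_ge0 : 0 <= L) (h_lipschitz : elipschitz L h).
Hypotheses (beta_ge0 : 0 <= beta) (c_diff : forall x, differentiable c x).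
Hypothesis c_smooth :
  forall x y, opnorm ('J c x - 'J c y) <= beta * enorm (x - y).
Hypothesis mut_gt0 : 0 < mut.

(** Real values of the objective, meaningful on the domain of g. *)
Definition composite (z : 'rV[R]_d) : R := fine (g z) + h (c z).

Lemma objective_fine z : edom g z -> objective g h c z = (composite z)%:E.
Proof. by move=> gz; rewrite /objective (edom_fineK _ g_proper z gz). Qed.

Lemma objective_edom z : (objective g h c z < +oo)%E -> edom g z.
Proof.
by rewrite /objective /edom /=; case: (g z) => [a||] //= _; exact: ltry.
Qed.

Lemma lipschitz_le u w : h u <= h w + L * enorm (u - w).
Proof. by have := h_lipschitz u w; rewrite ler_norml; lra. Qed.

Lemma perturb_le (zeta u : 'rV[R]_m) e : enorm zeta <= e ->
  h (zeta + u) <= h u + L * e /\ h u <= h (zeta + u) + L * e.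
Proof.
move=> zeta_le; have Le := ler_wpM2l L_ge0 zeta_le.
have := lipschitz_le (zeta + u) u; have := lipschitz_le u (zeta + u).
rewrite (enorm_distC u) addrK; lra.
Qed.

(** The model majorizes h o c once a quadratic with coefficient L beta / 2 is
    added; mut > L beta leaves a strict surplus. *)
Lemma model_upper y z : h (c z) <=
  h (linearization c y (z - y)) + L * beta / 2 * enorm (z - y) ^+ 2.
Proof.
have := lipschitz_le (c z) (linearization c y (z - y)).
have := ler_wpM2l L_ge0
  (linearization_error c beta y z beta_ge0 c_diff c_smooth).
lra.
Qed.

Lemma strongly_convex_x_model zeta y :
  strongly_convex mut (fun z => h (zeta + linearization c y (z - y))
    + mut / 2 * enorm (z - y) ^+ 2).
Proof.
have q_affine : affine_map (fun z => zeta + linearization c y (z - y)).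
  by move=> u w t; have := affine_model c zeta y y 1 u w t; rewrite !scale1r.
move=> u w t t01.
by have := strongly_convex_model h _ 1 mut y h_convex q_affine ler01 u w t t01;
  rewrite !mul1r.
Qed.

Lemma prox_model_x_subproblem y :
  prox_model g h c (1 / mut) y = x_subproblem g h c mut 0 y.
Proof.
apply/funext => z; rewrite /prox_model /x_subproblem add0r.
have -> // : 1 / (2 * (1 / mut)) = mut / 2.
by field; rewrite gt_eqF.
Qed.

(** [prox_step] picks a point of the set of minimizers, so that set must be
    inhabited.  The perturbed model, which has the minimizer x, stays within
    L |zeta| of the unperturbed one and so bounds it below. *)
Lemma prox_step_argmin zeta y x : lower_semicontinuous g ->
  argmin (x_subproblem g h c mut zeta y) x ->
  argmin (x_subproblem g h c mut 0 y) (prox_step g h c (1 / mut) y).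
Proof.
move=> g_lsc x_min; rewrite -prox_model_x_subproblem.
apply: (@getPex _ (argmin _)).
rewrite prox_model_x_subproblem.
have sc0 := strongly_convex_x_model 0 y.
have scz := strongly_convex_x_model zeta y.
pose b := fine (g x) + (h (zeta + linearization c y (x - y))
    + mut / 2 * enorm (x - y) ^+ 2) - L * enorm zeta.
apply: (strongly_convex_argmin_exists g g_proper g_convex mut b _ mut_gt0
  g_lsc sc0).
- have lin_cont := elipschitz_continuous _ _
    (elipschitz_linearization h c L y L_ge0 h_lipschitz).
  have -> : (fun z => h (0 + linearization c y (z - y))
      + mut / 2 * enorm (z - y) ^+ 2) =
    (fun z => h (linearization c y (z - y))) \+
      (fun z => mut / 2 * enorm (z - y) ^+ 2).
    by apply/funext => z; rewrite /= add0r.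
  move=> z; apply: continuousD; first exact: lin_cont.
  exact: enorm_sqr_continuous.
- move=> z gz; rewrite /b add0r.
  have := argmin_growth g g_proper g_convex mut _ x z scz x_min gz.
  have [le_h _] := perturb_le zeta (linearization c y (z - y)) _ (lexx _).
  have : 0 <= mut / 2 * enorm (z - x) ^+ 2.
    by rewrite mulr_ge0 ?sqr_ge0 ?divr_ge0 ?ltW.
  move: le_h; lra.
Qed.

(** Add the growth inequalities of the two problems, each at the minimizer of
    the other: their values cancel up to two perturbations of size L e. *)
Lemma inexact_prox_dist zeta e y x s : enorm zeta <= e ->
  argmin (x_subproblem g h c mut zeta y) x ->
  argmin (x_subproblem g h c mut 0 y) s ->
  mut * enorm (x - s) ^+ 2 <= 2 * L * e.
Proof.
move=> zeta_le x_min s_min.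
have gx := argmin_edom g g_proper _ x x_min.
have gs := argmin_edom g g_proper _ s s_min.
have := argmin_growth g g_proper g_convex mut _ x s
  (strongly_convex_x_model zeta y) x_min gs.
have := argmin_growth g g_proper g_convex mut _ s x
  (strongly_convex_x_model 0 y) s_min gx.
have [_] := perturb_le zeta (linearization c y (x - y)) e zeta_le.
have [+ _] := perturb_le zeta (linearization c y (s - y)) e zeta_le.
rewrite !add0r (enorm_distC s x); lra.
Qed.

Lemma prox_gradient_sqr_le zeta e y x : lower_semicontinuous g ->
  enorm zeta <= e -> argmin (x_subproblem g h c mut zeta y) x ->
  enorm (prox_gradient g h c (1 / mut) y) ^+ 2 <=
  2 * mut ^+ 2 * enorm (x - y) ^+ 2 + 4 * mut * L * e.
Proof.
move=> g_lsc zeta_le x_min.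
rewrite /prox_gradient enormZ exprMn real_normK ?num_real//.
set s := prox_step _ _ _ _ _; rewrite div1r invrK.
have s_min := prox_step_argmin zeta y x g_lsc x_min.
have := inexact_prox_dist zeta e y x s zeta_le x_min s_min.
have := enorm_sqrD_le y x s; rewrite (enorm_distC y x).
move: (enorm _ ^+ 2) (enorm _ ^+ 2) (enorm _ ^+ 2) => A B C AB Ce.
have := ler_wpM2l (sqr_ge0 mut) AB.
have := ler_wpM2l (ltW mut_gt0) Ce; rewrite expr2; lra.
Qed.

Variables (r rho D : R).
Hypothesis r_pair : pair_convexity_constant (edom g) h c r.
Hypothesis rho_weak : weak_convexity_constant (edom g) (h \o c) rho.
(* D bounds the squared diameter only where it is weighted by r or rho, so
   that r = rho = 0 allows D = 0 on an unbounded domain. *)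
Hypothesis r_diam :
  forall p q, edom g p -> edom g q -> r * enorm (p - q) ^+ 2 <= r * D.
Hypothesis rho_diam :
  forall p q, edom g p -> edom g q -> rho * enorm (p - q) ^+ 2 <= rho * D.

(** The chain of comparisons is: F (x') to the x-model by [model_upper]; x' to
    w v' = a v' + (1 - a) x by minimality; the x-model at w v' to a times the
    v-subproblem at v', because w v' - y = a (v' - v); v' to xs by minimality;
    and the model at w xs back to F by the pair constant r and by the weak
    convexity constant rho.  Each of zeta and xi perturbs two of these
    comparisons. *)
Lemma accel_step (a e del : R) (zeta xi : 'rV[R]_m)
    (x v x' v' xs : 'rV[R]_d) :
  let y := a *: v + (1 - a) *: x in
  0 < a <= 1 -> enorm zeta <= e -> enorm xi <= del ->
  edom g x -> edom g v -> edom g xs ->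
  argmin (x_subproblem g h c mut zeta y) x' ->
  argmin (v_subproblem g h c mut a xi y v) v' ->
  composite x' + mut * a ^+ 2 / 2 * enorm (xs - v') ^+ 2
    + (mut - L * beta) / 2 * enorm (x' - y) ^+ 2 <=
  a * composite xs + (1 - a) * composite x
    + mut * a ^+ 2 / 2 * enorm (xs - v) ^+ 2
    + (r * a ^+ 2 / 2 + rho * a * (1 - a)) * D + 2 * L * (e + del).
Proof.
move=> y /andP[a0 a1] zeta_le xi_le gx gv gxs x'_min v'_min.
have a01 : 0 <= a <= 1 by rewrite ltW.
have gx' := argmin_edom g g_proper _ x' x'_min.
have gv' := argmin_edom g g_proper _ v' v'_min.
have gy : edom g y := edom_convex g g_proper g_convex v x a gv gx a01.
pose w u := a *: u + (1 - a) *: x.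
have gw u (gu : edom g u) : edom g (w u) :=
  edom_convex g g_proper g_convex u x a gu gx a01.
have wy u : w u - y = a *: (u - v).
  by apply/rowP => i; rewrite /w /y !mxE; ring.
have w_dist u : enorm (w u - y) ^+ 2 = a ^+ 2 * enorm (u - v) ^+ 2.
  by rewrite wy enormZ exprMn real_normK ?num_real.
have w_fine u (gu : edom g u) :
    fine (g (w u)) <= a * fine (g u) + (1 - a) * fine (g x) :=
  fine_convex g g_proper g_convex u x a gu gx a01.
have x_growth := argmin_growth g g_proper g_convex mut _ x' (w v')
  (strongly_convex_x_model zeta y) x'_min (gw v' gv').
rewrite /= w_dist wy in x_growth.
have v_sc : strongly_convex (mut * a) (fun u =>
    1 / a * h (xi + linearization c y (a *: (u - v)))
    + mut * a / 2 * enorm (u - v) ^+ 2).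
  apply: (strongly_convex_model h
    (fun u => xi + linearization c y (a *: (u - v)))) => //.
    exact: affine_model.
  by rewrite divr_ge0// ltW.
have v_growth := argmin_growth g g_proper g_convex (mut * a) _ v' xs
  v_sc v'_min gxs.
rewrite /= -(ler_pM2l a0) in v_growth.
have [_ x_pert] := perturb_le zeta (linearization c y (x' - y)) e zeta_le.
have [v_pert _] :=
  perturb_le zeta (linearization c y (a *: (v' - v))) e zeta_le.
have [_ v_pert'] :=
  perturb_le xi (linearization c y (a *: (v' - v))) del xi_le.
have [xs_pert _] :=
  perturb_le xi (linearization c y (a *: (xs - v))) del xi_le.
have x_upper := model_upper y x'.
have xs_pair := r_pair (w xs) y (gw xs gxs) gy.
rewrite w_dist wy in xs_pair.
have r_le := ler_wpM2l (sqr_ge0 a) (r_diam xs v gxs gv).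
have rho_le := ler_wpM2l (mulr_ge0 (ltW a0) (eqbRL (subr_ge0 a 1) a1))
  (rho_diam xs x gxs gx).
have xs_weak := rho_weak xs x a gxs gx a01; rewrite /= -/(w xs) in xs_weak.
have v_fine := w_fine v' gv'.
have drop : 0 <= mut / 2 * enorm (w v' - x') ^+ 2.
  by rewrite mulr_ge0 ?sqr_ge0 ?divr_ge0 ?ltW.
have aV : a * (1 / a) = 1 by field; rewrite gt_eqF.
rewrite /composite.
set hv' := h (xi + _) in v_growth v_pert'.
set hxs := h (xi + linearization c y (a *: (xs - v))) in v_growth xs_pert.
set Vv := enorm (v' - v) ^+ 2 in x_growth v_growth.
set Vs := enorm (xs - v) ^+ 2 in v_growth r_le xs_pair *.
set Vs' := enorm (xs - v') ^+ 2 in v_growth *.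
have lhsE : a * (fine (g v') + (1 / a * hv' + mut * a / 2 * Vv)
    + mut * a / 2 * Vs') =
    a * fine (g v') + hv' + mut * a ^+ 2 / 2 * Vv + mut * a ^+ 2 / 2 * Vs'.
  by field; rewrite gt_eqF.
have rhsE : a * (fine (g xs) + (1 / a * hxs + mut * a / 2 * Vs)) =
    a * fine (g xs) + hxs + mut * a ^+ 2 / 2 * Vs.
  by field; rewrite gt_eqF.
rewrite lhsE rhsE {lhsE rhsE aV v_sc} /= in v_growth *.
lra.
Qed.

Variables (eps delta : nat -> R) (x v : nat -> 'rV[R]_d).
Variables (zeta xi : nat -> 'rV[R]_m) (xs : 'rV[R]_d).
Hypotheses (g_lsc : lower_semicontinuous g) (mut_gt : L * beta < mut).
Hypothesis eps_ge0 : forall k, (1 <= k)%N -> 0 <= eps k.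
Hypotheses (x0_dom : edom g (x 0%N)) (v0_dom : edom g (v 0%N)).
Hypothesis zeta_le : forall k, (1 <= k)%N -> enorm (zeta k) <= eps k.
Hypothesis x_min : forall k, (1 <= k)%N ->
  argmin (x_subproblem g h c mut (zeta k) (accel_point x v k)) (x k).
Hypothesis xi_le : forall k, (1 <= k)%N -> enorm (xi k) <= delta k.
Hypothesis v_min : forall k, (1 <= k)%N ->
  argmin (v_subproblem g h c mut (accel_weight R k) (xi k)
            (accel_point x v k) (v k.-1)) (v k).
Hypothesis xs_le : forall k, (1 <= k)%N ->
  (objective g h c xs <= objective g h c (x k))%E.

Lemma x_iterate_edom k : edom g (x k).
Proof.
case: k => // k.
exact: argmin_edom g g_proper _ _ (x_min k.+1 (ltn0Sn k)).
Qed.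

Lemma v_iterate_edom k : edom g (v k).
Proof.
case: k => // k.
exact: argmin_edom g g_proper _ _ (v_min k.+1 (ltn0Sn k)).
Qed.

Lemma comparison_edom : edom g xs.
Proof.
apply: objective_edom; apply: le_lt_trans (xs_le 1%N isT) _.
by rewrite (objective_fine _ (x_iterate_edom 1)) ltry.
Qed.

(** The common source of both rates: one nonnegative term on the left is
    dropped to bound the other. *)
Lemma accel_energy N :
  let a := accel_weight R in
  (1 <= N)%N ->
  (composite (x N) - composite xs) * (N%:R + 1) ^+ 2 / 4
  + (mut - L * beta) / 2 *
    (\sum_(1 <= j < N.+1) enorm (x j - accel_point x v j) ^+ 2 / a j ^+ 2) <=
  mut / 2 * enorm (xs - v 0%N) ^+ 2
  + N%:R / 2 * (D * (r + rho / 2 * (N%:R - 1)))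
  + 2 * L * (\sum_(1 <= j < N.+1) (eps j + delta j) / a j ^+ 2).
Proof.
move=> a N1; have gxs := comparison_edom.
have gap_ge0 k : (1 <= k)%N -> 0 <= composite (x k) - composite xs.
  move=> /xs_le; rewrite !objective_fine//; last exact: x_iterate_edom.
  by rewrite lee_fin subr_ge0.
have step k : (1 <= k)%N ->
    composite (x k) - composite xs
      + mut * a k ^+ 2 / 2 * enorm (xs - v k) ^+ 2
      + (mut - L * beta) / 2 * enorm (x k - accel_point x v k) ^+ 2 <=
    (1 - a k) * (composite (x k.-1) - composite xs)
      + mut * a k ^+ 2 / 2 * enorm (xs - v k.-1) ^+ 2
      + (r * D * a k ^+ 2 / 2 + rho * D * a k * (1 - a k))
      + 2 * L * (eps k + delta k).
  move=> k1.
  have := accel_step (a k) (eps k) (delta k) (zeta k) (xi k) (x k.-1) (v k.-1)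
    (x k) (v k) xs (accel_weight_gt0_le1 k k1) (zeta_le k k1) (xi_le k k1)
    (x_iterate_edom _) (v_iterate_edom _) gxs (x_min k k1) (v_min k k1).
  rewrite -/(accel_point x v k); lra.
have := accel_telescope (fun k => composite (x k) - composite xs)
  (fun k => enorm (xs - v k) ^+ 2)
  (fun k => enorm (x k - accel_point x v k) ^+ 2)
  (fun k => 2 * L * (eps k + delta k))
  mut (mut - L * beta) (r * D) (rho * D) N gap_ge0 step N1.
rewrite -/a /=.
have -> : \sum_(1 <= j < N.+1) 2 * L * (eps j + delta j) / a j ^+ 2 =
    2 * L * \sum_(1 <= j < N.+1) (eps j + delta j) / a j ^+ 2.
  by rewrite mulr_sumr; apply: eq_bigr => j _; rewrite mulrA.
have : 0 <= mut / 2 * enorm (xs - v N) ^+ 2.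
  by rewrite mulr_ge0 ?sqr_ge0 ?divr_ge0 ?ltW.
move: (\sum_(_ <= _ < _) _) (\sum_(_ <= _ < _) _) => S T.
lra.
Qed.

Lemma accel_gap N :
  let a := accel_weight R in
  (1 <= N)%N ->
  composite (x N) - composite xs <=
  (2 * mut * enorm (v 0%N - xs) ^+ 2
   + 2 * N%:R * (D * (r + rho / 2 * (N%:R - 1)))
   + 8 * L * (\sum_(1 <= j < N.+1) (eps j + delta j) / a j ^+ 2))
  / (N%:R + 1) ^+ 2.
Proof.
move=> a N1; have := accel_energy N N1; rewrite -/a (enorm_distC xs).
have W_ge0 : 0 <= \sum_(1 <= j < N.+1)
    enorm (x j - accel_point x v j) ^+ 2 / a j ^+ 2.
  by apply: sumr_ge0 => j _; rewrite divr_ge0 ?sqr_ge0.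
have kappa_ge0 : 0 <= (mut - L * beta) / 2.
  by rewrite divr_ge0// subr_ge0 ltW.
have := mulr_ge0 kappa_ge0 W_ge0.
have n1 : 0 < (N%:R + 1) ^+ 2 :> R by rewrite exprn_gt0// ltr_wpDl.
rewrite ler_pdivlMr//; lra.
Qed.

Lemma accel_min_prox_gradient N :
  let a := accel_weight R in
  let n := N%:R : R in
  let Gsq := fun j => enorm (prox_gradient g h c (1 / mut)
                               (accel_point x v j)) ^+ 2 in
  (1 <= N)%N ->
  \big[Num.min/Gsq 1%N]_(1 <= j < N.+1) Gsq j <=
  48 * mut ^+ 2 / (mut - L * beta) *
    (mut * enorm (xs - v 0%N) ^+ 2 / (n * (n + 1) * (2 * n + 1))
     + D * (r + rho / 2 * (n - 1)) / ((n + 1) * (2 * n + 1))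
     + 4 * L * (\sum_(1 <= j < N.+1) (2 * eps j + delta j) / a j ^+ 2)
         / (n * (n + 1) * (2 * n + 1))).
Proof.
move=> a n Gsq N1; set mG := \big[_/_]_(_ <= _ < _) _.
have gxs := comparison_edom.
pose SW := \sum_(1 <= j < N.+1)
  enorm (x j - accel_point x v j) ^+ 2 / a j ^+ 2.
pose Seps := \sum_(1 <= j < N.+1) eps j / a j ^+ 2.
pose Sdel := \sum_(1 <= j < N.+1) delta j / a j ^+ 2.
pose kappa := mut - L * beta.
have kappa_gt0 : 0 < kappa by rewrite subr_gt0.
(* kappa <= mut lets the term 4 mut L eps, which comes from the distance
   between x j and the exact prox step, share the factor mut ^ 2 / kappa;
   this turns eps + delta into 2 eps + delta. *)
have kappa_le : kappa <= mut by rewrite gerBl mulr_ge0.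
have n_ge1 : 1 <= n by rewrite ler1n.
have n_gt0 : 0 < n by rewrite ltr0n.
have mG_ge0 : 0 <= mG.
  by apply: le_bigmin => [|j _]; exact: sqr_ge0.
have mG_sum : mG * (\sum_(1 <= j < N.+1) 1 / a j ^+ 2) <=
    2 * mut ^+ 2 * SW + 4 * mut * L * Seps.
  rewrite !mulr_sumr -big_split/= big_nat [leRHS]big_nat.
  apply: ler_sum => j /andP[j1 jN].
  have -> : 2 * mut ^+ 2 * (enorm (x j - accel_point x v j) ^+ 2 / a j ^+ 2)
    + 4 * mut * L * (eps j / a j ^+ 2) =
    (2 * mut ^+ 2 * enorm (x j - accel_point x v j) ^+ 2
      + 4 * mut * L * eps j) / a j ^+ 2 by ring.
  rewrite mulrA mulr1 ler_wpM2r ?invr_ge0 ?sqr_ge0//.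
  apply: le_trans (prox_gradient_sqr_le (zeta j) (eps j) _ (x j) g_lsc
    (zeta_le j j1) (x_min j j1)).
  by apply: ge_bigmin_seq => //; rewrite mem_index_iota j1.
have mG_cube : mG * (n * (n + 1) * (2 * n + 1) / 24) <=
    2 * mut ^+ 2 * SW + 4 * mut * L * Seps.
  apply: le_trans mG_sum; rewrite ler_wpM2l//.
  exact: sum_accel_weight_inv_ge.
have energy : kappa * SW <= mut * enorm (xs - v 0%N) ^+ 2
    + n * (D * (r + rho / 2 * (n - 1))) + 4 * L * (Seps + Sdel).
  have := accel_energy N N1; rewrite -/a -/n -/SW -/kappa.
  have -> : \sum_(1 <= j < N.+1) (eps j + delta j) / a j ^+ 2 = Seps + Sdel.
    by rewrite -big_split; apply: eq_bigr => j _; rewrite mulrDl.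
  have gap_ge0 : 0 <= composite (x N) - composite xs.
    have := xs_le N N1; rewrite !objective_fine//; last exact: x_iterate_edom.
    by rewrite lee_fin subr_ge0.
  have := mulr_ge0 gap_ge0 (sqr_ge0 (n + 1)); lra.
have Seps_ge0 : 0 <= L * Seps.
  rewrite mulr_ge0// /Seps big_nat sumr_ge0// => j /andP[j1 _].
  by rewrite divr_ge0 ?sqr_ge0// eps_ge0.
have -> : \sum_(1 <= j < N.+1) (2 * eps j + delta j) / a j ^+ 2 =
    2 * Seps + Sdel.
  rewrite /Seps mulr_sumr -big_split; apply: eq_bigr => j _.
  by rewrite mulrDl mulrA.
set B := mut * enorm (xs - v 0%N) ^+ 2 + n * (D * (r + rho / 2 * (n - 1)))
  + 4 * L * (2 * Seps + Sdel).
rewrite -/kappa.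
have -> : 48 * mut ^+ 2 / kappa *
    (mut * enorm (xs - v 0%N) ^+ 2 / (n * (n + 1) * (2 * n + 1))
     + D * (r + rho / 2 * (n - 1)) / ((n + 1) * (2 * n + 1))
     + 4 * L * (2 * Seps + Sdel) / (n * (n + 1) * (2 * n + 1))) =
    2 * mut ^+ 2 * B / (kappa * (n * (n + 1) * (2 * n + 1) / 24)).
  by rewrite /B; field; rewrite !gt_eqF//; lra.
rewrite ler_pdivlMr; last first.
  by rewrite !mulr_gt0 ?invr_gt0//; lra.
have -> : mG * (kappa * (n * (n + 1) * (2 * n + 1) / 24)) =
  kappa * (mG * (n * (n + 1) * (2 * n + 1) / 24)) by ring.
apply: le_trans (ler_wpM2l (ltW kappa_gt0) mG_cube) _.
have := ler_wpM2l (mulr_ge0 (ler0n R 2) (sqr_ge0 mut)) energy.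
have := ler_wpM2r (mulr_ge0 (ltW mut_gt0) Seps_ge0) kappa_le.
have := mulr_ge0 (sqr_ge0 mut) Seps_ge0.
by rewrite /B; lra.
Qed.

End composite_step.

(** * Convergence rates *)

Theorem theorem8p8 (R : realType) (d m : nat)
  (g : 'rV[R]_d -> \bar R) (h : 'rV[R]_m -> R) (c : 'rV[R]_d -> 'rV[R]_m)
  (L beta rho r mut : R)
  (g_proper : eproper g) (g_closed : lower_semicontinuous g)
  (g_convex : econvex g)
  (L_ge0 : 0 <= L) (h_convex : convex_function setT h)
  (h_lipschitz : elipschitz L h)
  (beta_ge0 : 0 <= beta) (c_C1 : C1 c)
  (c_smooth : forall x y, opnorm ('J c x - 'J c y) <= beta * enorm (x - y))
  (rho_ge0 : 0 <= rho)
  (rho_weak : weak_convexity_constant (edom g) (h \o c) rho)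
  (r_ge0 : 0 <= r) (r_pair : pair_convexity_constant (edom g) h c r)
  (mut_gt : L * beta < mut)
  (eps delta : nat -> R)
  (eps_ge0 : forall k, (1 <= k)%N -> 0 <= eps k)
  (delta_ge0 : forall k, (1 <= k)%N -> 0 <= delta k)
  (x v : nat -> 'rV[R]_d) (zeta xi : nat -> 'rV[R]_m)
  (x0_dom : edom g (x 0%N)) (v0_dom : edom g (v 0%N))
  (zeta_le : forall k, (1 <= k)%N -> enorm (zeta k) <= eps k)
  (x_min : forall k, (1 <= k)%N ->
    argmin (x_subproblem g h c mut (zeta k) (accel_point x v k)) (x k))
  (xi_le : forall k, (1 <= k)%N -> enorm (xi k) <= delta k)
  (v_min : forall k, (1 <= k)%N ->
    argmin (v_subproblem g h c mut (accel_weight R k) (xi k)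
              (accel_point x v k) (v k.-1)) (v k))
  (xstar : 'rV[R]_d)
  (xstar_le : forall k, (1 <= k)%N ->
    (objective g h c xstar <= objective g h c (x k))%E)
  (N : nat) (N_ge1 : (1 <= N)%N) :
  let mu := L * beta in
  let M := ediam (edom g) in
  let F := objective g h c in
  let a := accel_weight R in
  let n := N%:R : R in
  let Gsq := fun j => enorm (prox_gradient g h c (1 / mut)
                               (accel_point x v j)) ^+ 2 in
  let minGsq := \big[Num.min/Gsq 1%N]_(1 <= j < N.+1) Gsq j in
  let T1 := mut * enorm (xstar - v 0%N) ^+ 2
            / (n * (n + 1) * (2 * n + 1)) in
  let T2 := fine M ^+ 2 * (r + rho / 2 * (n + 3))
            / ((n + 1) * (2 * n + 1)) in
  let T3 := 4 * L * (\sum_(1 <= j < N.+1) (2 * eps j + delta j) / a j ^+ 2)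
            / (n * (n + 1) * (2 * n + 1)) in
  ((M < +oo)%E ->
     minGsq <= 48 * mut ^+ 2 / (mut - mu) * (T1 + T2 + T3)) /\
  (r = 0 ->
     minGsq <= 48 * mut ^+ 2 / (mut - mu) * (T1 + 0 + T3) /\
     (F (x N) - F xstar <=
       ((2 * mut * enorm (v 0%N - xstar) ^+ 2
         + 8 * L * (\sum_(1 <= j < N.+1) (eps j + delta j) / a j ^+ 2))
        / (n + 1) ^+ 2)%:E)%E).

Proof.
move=> mu M F a n Gsq minGsq T1 T2 T3.
have mut_gt0 : 0 < mut by apply: le_lt_trans mut_gt; exact: mulr_ge0.
have [c_diff _] := c_C1.
have n_ge1 : 1 <= n by rewrite ler1n.
have min_bound r' rho' D pair' weak' r_diam rho_diam :=
  accel_min_prox_gradient g h c L beta mut g_proper g_convex h_convex L_ge0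
    h_lipschitz beta_ge0 c_diff c_smooth mut_gt0 r' rho' D pair' weak'
    r_diam rho_diam eps delta x v zeta xi xstar g_closed mut_gt eps_ge0
    x0_dom v0_dom zeta_le x_min xi_le v_min xstar_le N N_ge1.
split=> [M_fin|r0].
  have sqr_diam s p q : 0 <= s -> edom g p -> edom g q ->
      s * enorm (p - q) ^+ 2 <= s * fine M ^+ 2.
    by move=> s0 gp gq; rewrite ler_wpM2l// ediam_enorm_sqr_le.
  apply: le_trans (min_bound r rho (fine M ^+ 2) r_pair rho_weak _ _) _.
  - by move=> p q; exact: sqr_diam.
  - by move=> p q; exact: sqr_diam.
  rewrite ler_wpM2l//.
    by apply: divr_ge0; [rewrite mulr_ge0 ?sqr_ge0|rewrite subr_ge0 ltW].
  rewrite lerD2r lerD2l /T2 ler_wpM2r//.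
  rewrite ler_wpM2l ?sqr_ge0// lerD2l ler_wpM2l ?divr_ge0//; lra.
have pair0 : pair_convexity_constant (edom g) h c 0 by rewrite -r0.
have weak0 : weak_convexity_constant (edom g) (h \o c) 0.
  apply: pair_convexity0_convex => // p q t gp gq t01.
  exact: edom_convex.
have diam0 p q : edom g p -> edom g q -> 0 * enorm (p - q) ^+ 2 <= 0 * 0.
  by move=> _ _; rewrite !mul0r.
split; first by have := min_bound 0 0 0 pair0 weak0 diam0 diam0; rewrite !mul0r.
have := accel_gap g h c L beta mut g_proper g_convex h_convex L_ge0
  h_lipschitz beta_ge0 c_diff c_smooth mut_gt0 0 0 0 pair0 weak0 diam0 diam0
  eps delta x v zeta xi xstar mut_gt x0_dom v0_dom zeta_le x_min xi_le v_min
  xstar_le N N_ge1.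
have gxN : edom g (x N) := x_iterate_edom g h c mut g_proper x v zeta x0_dom
  x_min N.
have gxs : edom g xstar := comparison_edom g h c mut g_proper x v zeta xstar
  x0_dom x_min xstar_le.
rewrite /F (objective_fine g h c g_proper _ gxN).
rewrite (objective_fine g h c g_proper _ gxs) -EFinB lee_fin.
by rewrite mul0r mulr0 addr0.
Qed.
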